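(* Let $A\in\mathcal{R}(\mathbb{T},\mathbb{H}^{n\times n})$ and let $M(t)=(x_1(t),\dots,x_n(t))$ be a fundamental solution matrix of $\phi^\Delta(t)=A(t)\phi(t)$. Then any solution $x(t)$ of $\phi^\Delta(t)=A(t)\phi(t)$ can be written as $x(t)=M(t)q$ for all $t\in\mathbb{T}$, for some constant vector $q=(q_1,\dots,q_n)^\top\in\mathbb{H}^n$. The totality of the solutions forms a right $\mathbb{H}$-module.
   Context: A time scale $\mathbb{T}$ is a nonempty closed subset of $\mathbb{R}$. For $t\in\mathbb{T}$: $\sigma(t)=\inf\{s\in\mathbb{T}:s>t\}$, $\rho(t)=\sup\{s\in\mathbb{T}:s<t\}$ (with $\inf\emptyset=\sup\mathbb{T}$, $\sup\emptyset=\inf\mathbb{T}$), $\mu(t)=\sigma(t)-t$. The point $t$ is right-dense if $\sigma(t)=t$ and left-dense if $\rho(t)=t$. $\mathbb{T}^\kappa=\mathbb{T}\setminus(\rho(\sup\mathbb{T}),\sup\mathbb{T}]$ if $\sup\mathbb{T}<\infty$, and $\mathbb{T}^\kappa=\mathbb{T}$ otherwise. $\mathbb{H}$ is the skew field of quaternions. A function $f:\mathbb{T}\to\mathbb{H}$ has delta derivative $f^\Delta(t)$ at $t\in\mathbb{T}^\kappa$ if for every $\varepsilon>0$ there is $\delta>0$ with $|f(\sigma(t))-f(s)-f^\Delta(t)(\sigma(t)-s)|\le\varepsilon|\sigma(t)-s|$ for all $s\in(t-\delta,t+\delta)\cap\mathbb{T}$. $f$ is rd-continuous if each of its four real components is continuous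 at right-dense points and has finite left-sided limits at left-dense points. For vector- and matrix-valued functions these notions are entrywise. $\mathcal{R}(\mathbb{T},\mathbb{H}^{n\times n})$ is the set of rd-continuous $A:\mathbb{T}\to\mathbb{H}^{n\times n}$ that are regressive, i.e. $I_n+\mu(t)A(t)$ is invertible for all $t\in\mathbb{T}^\kappa$. A solution of $\phi^\Delta=A\phi$ is a delta differentiable $\phi:\mathbb{T}\to\mathbb{H}^n$ with $\phi^\Delta(t)=A(t)\phi(t)$ for all $t\in\mathbb{T}^\kappa$. Functions $x_1,\dots,x_n:\mathbb{T}\to\mathbb{H}^n$ are right linearly independent on $\mathbb{T}$ if $x_1(t)\alpha_1+\dots+x_n(t)\alpha_n=0$ for all $t\in\mathbb{T}$, with $\alpha_i\in\mathbb{H}$, implies all $\alpha_i=0$. A fundamental solution matrix is an $n\times n$ matrix function whose columns are $n$ right linearly independent solutions. *)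

(* Defs.v *)
From HB Require Import structures.
From mathcomp Require Import all_boot all_order all_algebra.
From mathcomp Require Import all_classical all_reals all_analysis.
From mathcomp Require Import ring.

Set Implicit Arguments.
Unset Strict Implicit.
Unset Printing Implicit Defensive.

Import Order.TTheory GRing.Theory Num.Theory.
Import numFieldNormedType.Exports.

Local Open Scope classical_set_scope.
Local Open Scope ring_scope.

(* Quat a b c d is a + b i + c j + d k, with i^2 = j^2 = k^2 = i j k = -1. *)
Record quat (R : realType) := Quat { qre : R; qi : R; qj : R; qk : R }.

Section QuaternionRing.
Variable R : realType.
Implicit Types x y z : quat R.

Definition quat_tuple x := (qre x, qi x, qj x, qk x).
Definition tuple_quat (p : R * R * R * R) :=
  let: (a, b, c, d) := p in Quat a b c d.
Lemma quat_tupleK : cancel quat_tuple tuple_quat. Proof. by case. Qed.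
HB.instance Definition _ := Choice.copy (quat R) (can_type quat_tupleK).

Definition quat_add x y :=
  Quat (qre x + qre y) (qi x + qi y) (qj x + qj y) (qk x + qk y).
Definition quat_opp x := Quat (- qre x) (- qi x) (- qj x) (- qk x).
Definition quat_mul x y :=
  Quat (qre x * qre y - qi x * qi y - qj x * qj y - qk x * qk y)
       (qre x * qi y + qi x * qre y + qj x * qk y - qk x * qj y)
       (qre x * qj y - qi x * qk y + qj x * qre y + qk x * qi y)
       (qre x * qk y + qi x * qj y - qj x * qi y + qk x * qre y).

Lemma quat_addA : associative quat_add.
Proof. by move=> x y z; rewrite /quat_add /= !addrA. Qed.
Lemma quat_addC : commutative quat_add.
Proof. by move=> x y; congr Quat; exact: addrC. Qed.
Lemma quat_add0 : left_id (Quat 0 0 0 0) quat_add.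
Proof. by case=> a b c d; rewrite /quat_add /= !add0r. Qed.
Lemma quat_addN : left_inverse (Quat 0 0 0 0) quat_opp quat_add.
Proof. by case=> a b c d; rewrite /quat_add /= !addNr. Qed.
HB.instance Definition _ :=
  GRing.isZmodule.Build (quat R) quat_addA quat_addC quat_add0 quat_addN.

Lemma quat_mulA : associative quat_mul.
Proof.
by move=> [a b c d] [a' b' c' d'] [a'' b'' c'' d'']; congr Quat => /=; ring.
Qed.
Lemma quat_mul1l : left_id (Quat 1 0 0 0) quat_mul.
Proof. by case=> a b c d; congr Quat => /=; ring. Qed.
Lemma quat_mul1r : right_id (Quat 1 0 0 0) quat_mul.
Proof. by case=> a b c d; congr Quat => /=; ring. Qed.
Lemma quat_mulDl : left_distributive quat_mul +%R.
Proof.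
by move=> [a b c d] [a' b' c' d'] [a'' b'' c'' d'']; congr Quat => /=; ring.
Qed.
Lemma quat_mulDr : right_distributive quat_mul +%R.
Proof.
by move=> [a b c d] [a' b' c' d'] [a'' b'' c'' d'']; congr Quat => /=; ring.
Qed.
Lemma quat_1neq0 : Quat 1 0 0 0 != 0 :> quat R.
Proof. by apply/eqP => -[] /eqP; rewrite oner_eq0. Qed.
HB.instance Definition _ := GRing.Zmodule_isNzRing.Build (quat R)
  quat_mulA quat_mul1l quat_mul1r quat_mulDl quat_mulDr quat_1neq0.

End QuaternionRing.

Definition quat_real (R : realType) (a : R) : quat R := Quat a 0 0 0.

Definition quat_abs (R : realType) (q : quat R) : R :=
  Num.sqrt (qre q ^+ 2 + qi q ^+ 2 + qj q ^+ 2 + qk q ^+ 2).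

(* The library only has left modules, so the right H-module H^n is encoded as a
   left module over the converse ring H^c. It needs its own copy of the column
   type, since 'cV_n already is a left H-module. *)
Definition qcol (R : realType) (n : nat) : Type := 'cV[quat R]_n.

Section RightModule.
Variables (R : realType) (n : nat).

HB.instance Definition _ := GRing.Zmodule.copy (qcol R n) 'cV[quat R]_n.

Definition qcol_scale (a : (quat R)^c) (v : qcol R n) : qcol R n :=
  \col_i (v i 0 * (a : quat R)).

Lemma qcol_scaleA a b v :
  qcol_scale a (qcol_scale b v) = qcol_scale (a * b) v.
Proof. by apply/colP => i; rewrite !mxE -mulrA. Qed.
Lemma qcol_scale1 : left_id 1 qcol_scale.
Proof. by move=> v; apply/colP => i; rewrite !mxE mulr1. Qed.
Lemma qcol_scaleDr : right_distributive qcol_scale +%R.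
Proof. by move=> a u v; apply/colP => i; rewrite !mxE mulrDl. Qed.
Lemma qcol_scaleDl v : {morph qcol_scale^~ v : a b / a + b}.
Proof. by move=> a b; apply/colP => i; rewrite !mxE mulrDr. Qed.
HB.instance Definition _ := GRing.Zmodule_isLmodule.Build (quat R)^c (qcol R n)
  qcol_scaleA qcol_scale1 qcol_scaleDr qcol_scaleDl.

End RightModule.

Record timeScale (R : realType) := TimeScale {
  ts_set :> set R;
  ts_nonempty : ts_set !=set0;
  ts_closed : closed ts_set
}.

Section TimeScale.
Variables (R : realType) (T : timeScale R).

Definition fwd_jump (t : R) : R :=
  if pselect (exists s, ts_set T s /\ t < s) then inf [set s | ts_set T s /\ t < s]
  else sup T.

Definition bwd_jump (t : R) : R :=
  if pselect (exists s, ts_set T s /\ s < t) then sup [set s | ts_set T s /\ s < t]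
  else inf T.

Lemma fwd_jump_in (t : T) : fwd_jump (\val t) \in (T : set R).
Proof.
have Tt := set_valP t.
apply/mem_set; rewrite /fwd_jump; case: pselect => [[s [Ts ts]]|nex].
  have hi : has_inf [set s | ts_set T s /\ \val t < s].
    by split; [exists s | exists (\val t) => y [_ /ltW]].
  apply: ts_closed => B /nbhs_ballP[e /= e0 eB].
  have [y [Ty ty] ye] := inf_adherent e0 hi.
  exists y; split=> //; apply: eB; rewrite /ball /= distrC ger0_norm.
    by rewrite ltrBlDl.
  by rewrite subr_ge0; apply: ge_inf => //; exact: hi.2.
suff -> : sup T = \val t by [].
have ub : ubound T (\val t).
  by move=> y Ty; rewrite leNgt; apply/negP => ty; apply: nex; exists y.
apply/eqP; rewrite eq_le; apply/andP; split.
  by apply: ge_sup => //; exists (\val t).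
by apply: ub_le_sup => //; exists (\val t).
Qed.

Definition sigma (t : T) : T := exist _ (fwd_jump (\val t)) (fwd_jump_in t).

Definition mu (t : T) : R := \val (sigma t) - \val t.

Definition right_dense (t : T) : Prop := \val (sigma t) = \val t.

Definition left_dense (t : T) : Prop := bwd_jump (\val t) = \val t.

Definition ts_kappa : set R :=
  if pselect (has_ubound T)
  then (T : set R) `\` [set` `]bwd_jump (sup T), sup T]]
  else T.

(* T carries the subspace topology. At min T the filter below contains the
   empty set, so the left-sided limit condition is vacuous there. *)
Definition rd_continuous_real (f : T -> R) : Prop :=
  (forall t : T, right_dense t -> {for t, continuous f}) /\
  (forall t : T, left_dense t -> exists l : R,
     f @ within [set s : T | \val s < \val t] (nbhs t) --> l).

Definition rd_continuous (f : T -> quat R) : Prop :=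
  [/\ rd_continuous_real (fun t => qre (f t)),
      rd_continuous_real (fun t => qi (f t)),
      rd_continuous_real (fun t => qj (f t)) &
      rd_continuous_real (fun t => qk (f t))].

Definition is_delta_derivative (f : T -> quat R) (t : T) (l : quat R) : Prop :=
  forall e : R, 0 < e -> exists2 d : R, 0 < d &
    forall s : T, \val t - d < \val s < \val t + d ->
      quat_abs (f (sigma t) - f s - l * quat_real (\val (sigma t) - \val s))
        <= e * `|\val (sigma t) - \val s|.

End TimeScale.

Section LinearSystem.
Variables (R : realType) (T : timeScale R) (n : nat).

Definition invertible_mx (B : 'M[quat R]_n) : Prop :=
  exists C : 'M[quat R]_n, B *m C = 1%:M /\ C *m B = 1%:M.

Definition rd_continuous_mx (A : T -> 'M[quat R]_n) : Prop :=
  forall i j, rd_continuous (fun t => A t i j).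

Definition regressive (A : T -> 'M[quat R]_n) : Prop :=
  forall t : T, ts_kappa T (\val t) ->
    invertible_mx (1%:M + quat_real (mu t) *: A t).

Definition is_delta_derivative_col (x : T -> qcol R n) (t : T) (l : qcol R n)
    : Prop :=
  forall i, is_delta_derivative (fun s => x s i 0) t (l i 0).

Definition is_solution (A : T -> 'M[quat R]_n) (x : T -> qcol R n) : Prop :=
  forall t : T, ts_kappa T (\val t) ->
    is_delta_derivative_col x t (A t *m x t).

Definition right_lin_indep (x : 'I_n -> T -> qcol R n) : Prop :=
  forall a : 'I_n -> (quat R)^c,
    (forall t : T, \sum_(i < n) a i *: x i t = 0) -> forall i, a i = 0.

Definition is_fundamental_mx (A M : T -> 'M[quat R]_n) : Prop :=
  (forall j, is_solution A (fun t => col j (M t))) /\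
  right_lin_indep (fun j t => col j (M t)).

End LinearSystem.

(* Main.v *)
(* A solution that vanishes at one point vanishes everywhere: its zero set is
   open (mean value inequality, using that A is locally bounded), its complement
   is open (continuity), and by regressivity x(t) = 0 iff x(sigma(t)) = 0, so
   induction along the time scale propagates zeros in both directions.  Hence
   M(t0) q = 0 forces M q = 0 identically, so q = 0 by independence of the
   columns; M(t0) is therefore injective on H^n, a real vector space of
   dimension 4n, hence surjective.  Choosing q with M(t0) q = x(t0), the
   solutions M q and x agree at t0, hence everywhere. *)
Require Import Defs.
From HB Require Import structures.
From mathcomp Require Import all_boot all_order all_algebra.
From mathcomp Require Import all_classical all_reals all_analysis.
From mathcomp Require Import ring lra.

Set Implicit Arguments.
Unset Strict Implicit.
Unset Printing Implicit Defensive.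

Import Order.TTheory GRing.Theory Num.Theory.
Import numFieldNormedType.Exports.

Local Open Scope classical_set_scope.
Local Open Scope ring_scope.

(** * The modulus on the quaternions: multiplicativity and triangle inequality *)

Section QuaternionAbs.
Variable R : realType.
Implicit Types (p q : quat R) (r : R).

Lemma quatP p q :
  qre p = qre q -> qi p = qi q -> qj p = qj q -> qk p = qk q -> p = q.
Proof. by case: p q => [? ? ? ?] [? ? ? ?] /= -> -> -> ->. Qed.

Definition quat_sq q : R := qre q ^+ 2 + qi q ^+ 2 + qj q ^+ 2 + qk q ^+ 2.

Lemma quat_sq_ge0 q : 0 <= quat_sq q.
Proof. by rewrite /quat_sq !addr_ge0 // sqr_ge0. Qed.

Lemma quat_absX2 q : quat_abs q ^+ 2 = quat_sq q.
Proof. by rewrite sqr_sqrtr // quat_sq_ge0. Qed.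

Lemma quat_abs_ge0 q : 0 <= quat_abs q.
Proof. exact: sqrtr_ge0. Qed.

(** Under the square root this is Euler's four-square identity, a polynomial identity left to
    [ring]. *)
Lemma quat_absM p q : quat_abs (p * q) = quat_abs p * quat_abs q.
Proof.
rewrite /quat_abs -sqrtrM ?quat_sq_ge0 //; congr Num.sqrt.
by case: p q => [a b c d] [a' b' c' d'] /=; ring.
Qed.

Lemma quat_absN q : quat_abs (- q) = quat_abs q.
Proof. by rewrite /quat_abs /= !sqrrN. Qed.

Lemma quat_abs0 : quat_abs (0 : quat R) = 0.
Proof. by rewrite /quat_abs /= !expr0n /= !addr0 sqrtr0. Qed.

Lemma quat_abs_eq0 q : quat_abs q = 0 -> q = 0.
Proof.
move=> q0; have := quat_absX2 q; rewrite q0 expr0n /= => /esym/eqP.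
rewrite /quat_sq !paddr_eq0 ?addr_ge0 ?sqr_ge0 // !sqrf_eq0.
by case: q {q0} => [a b c d] /= /andP[/andP[/andP[/eqP-> /eqP->] /eqP->] /eqP->].
Qed.

Lemma quat_abs_real r : quat_abs (quat_real r) = `|r|.
Proof. by rewrite /quat_abs /= !expr0n /= !addr0 sqrtr_sqr. Qed.

Lemma quat_realC r q : quat_real r * q = q * quat_real r.
Proof. by case: q => [a b c d]; apply: quatP => /=; ring. Qed.

Lemma quat_realD r r' : quat_real (r + r') = quat_real r + quat_real r'.
Proof. by apply: quatP => /=; rewrite ?addr0. Qed.

Lemma norm_qre_le q : `|qre q| <= quat_abs q.
Proof.
rewrite -sqrtr_sqr ler_wsqrtr // -!addrA lerDl.
by rewrite !addr_ge0 // sqr_ge0.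
Qed.

(* Cauchy-Schwarz, from [|Re z| <= |z| = |p| |q|] where [z] is [p] times the conjugate [q'] of [q]. *)
Lemma quat_abs_triangle p q : quat_abs (p + q) <= quat_abs p + quat_abs q.
Proof.
pose q' := Quat (qre q) (- qi q) (- qj q) (- qk q).
have q'E : quat_abs q' = quat_abs q by rewrite /quat_abs /= !sqrrN.
have := norm_qre_le (p * q').
rewrite quat_absM q'E => /(le_trans (ler_norm _)) h.
rewrite -(@ler_pXn2r _ 2) ?nnegrE ?addr_ge0 ?quat_abs_ge0 //.
rewrite sqrrD !quat_absX2 /quat_sq.
by move: h; set m := quat_abs p * quat_abs q => h; rewrite /= in h *; lra.
Qed.

Lemma quat_abs_sub p q : quat_abs (p - q) = quat_abs (q - p).
Proof. by rewrite -opprB quat_absN. Qed.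

Lemma quat_abs_dist p q s :
  quat_abs (p - s) <= quat_abs (p - q) + quat_abs (q - s).
Proof. by apply: le_trans (quat_abs_triangle _ _); rewrite addrA subrK. Qed.

Lemma quat_abs_sum (I : finType) (F : I -> quat R) :
  quat_abs (\sum_i F i) <= \sum_i quat_abs (F i).
Proof.
elim/big_ind2 : _ => [|p r q s hp hq|//]; first by rewrite quat_abs0.
exact: le_trans (quat_abs_triangle _ _) (lerD hp hq).
Qed.

(** After squaring, the two sides differ by twice the pairwise products of the absolute values, and
    these six products are nonnegative. This turns bounds on the real components into a bound on the
    modulus. *)
Lemma quat_abs_le_comp q :
  quat_abs q <= `|qre q| + `|qi q| + `|qj q| + `|qk q|.
Proof.
rewrite -(@ler_pXn2r _ 2) ?nnegrE ?addr_ge0 ?quat_abs_ge0 // quat_absX2.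
rewrite /quat_sq -(real_normK (num_real (qre q))) -(real_normK (num_real (qi q))).
rewrite -(real_normK (num_real (qj q))) -(real_normK (num_real (qk q))).
have := (normr_ge0 (qre q), normr_ge0 (qi q), normr_ge0 (qj q), normr_ge0 (qk q)).
move: `|_| `|_| `|_| `|_| => a b c d [[[a0 b0] c0] d0].
have := (mulr_ge0 a0 b0, mulr_ge0 a0 c0, mulr_ge0 a0 d0, mulr_ge0 b0 c0).
have := (mulr_ge0 b0 d0, mulr_ge0 c0 d0) => -[h1 h2] [[[h3 h4] h5] h6].
lra.
Qed.

End QuaternionAbs.

(** * Jump operators, the set [ts_kappa], and induction along a time scale *)

Section TimeScaleOrder.
Variables (R : realType) (T : timeScale R).
Implicit Types (s t a b : T) (d e : R).

Lemma val_sigma t : \val (sigma t) = fwd_jump T (\val t).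
Proof. by []. Qed.

Lemma sigma_le s t : \val t < \val s -> \val (sigma t) <= \val s.
Proof.
move=> ts; rewrite val_sigma /fwd_jump; case: pselect => /= [?|]; last first.
  by case; exists (\val s); split=> //; exact: set_valP.
apply: ge_inf; last by split=> //; exact: set_valP.
by exists (\val t) => y [_ /ltW].
Qed.

Lemma sigma_ge t : \val t <= \val (sigma t).
Proof.
rewrite val_sigma /fwd_jump; case: pselect => /= [ex|nex].
  by apply: lb_le_inf => // y [_ /ltW].
apply: ub_le_sup; last exact: set_valP.
by exists (\val t) => y Ty; rewrite leNgt; apply/negP => ty; apply: nex; exists y.
Qed.

Lemma sigma_max t : (forall s : T, \val s <= \val t) -> sigma t = t.
Proof.
move=> tmax; apply/val_inj/eqP; rewrite eq_le sigma_ge andbT.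
exact: tmax.
Qed.

(** A maximum of the time scale also counts as right-dense, through the default value [sup T]. The
    point [s] excludes this case, so [t] is a genuine infimum of points to its right. *)
Lemma right_dense_approx s t d : right_dense t -> \val t < \val s -> 0 < d ->
  exists2 u : T, \val t < \val u < \val t + d & \val u <= \val s.
Proof.
move=> td ts d0; have := td; rewrite /right_dense val_sigma /fwd_jump.
case: pselect => /= [ex infE|]; last first.
  by case; exists (\val s); split=> //; exact: set_valP.
have hi : has_inf [set u | ts_set T u /\ \val t < u].
  by split; [exact: ex | exists (\val t) => y [_ /ltW]].
(* The minimum secures both the distance below [d] and the bound by [s]. *)
have [|u [Tu tu] ud] := @inf_adherent _ _ (Num.min d (\val s - \val t)) _ hi.
  by rewrite lt_min d0 subr_gt0.
move: ud; rewrite infE => ud.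
exists (exist _ u (mem_set Tu)); rewrite /= ?tu /=.
  by apply: lt_le_trans ud _; rewrite lerD2l ge_min lexx.
apply/ltW/(lt_le_trans ud); rewrite -lerBrDl ge_min lexx orbT //.
Qed.

Lemma not_left_dense_gap t : ~ left_dense t ->
  exists2 d, 0 < d & forall s : T, \val t - d < \val s -> \val t <= \val s.
Proof.
rewrite /left_dense /bwd_jump; case: pselect => /= [[r [Tr rt]] nt|nex _].
  have hs : has_sup [set s | ts_set T s /\ s < \val t].
    by split; [exists r | exists (\val t) => y [_ /ltW]].
  have lt : sup [set s | ts_set T s /\ s < \val t] < \val t.
    rewrite lt_neqAle; apply/andP; split; first exact/eqP.
    by apply: ge_sup; [exists r | move=> y [_ /ltW]].
  exists (\val t - sup [set s | ts_set T s /\ s < \val t]).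
    by rewrite subr_gt0.
  move=> s; rewrite subKr leNgt => /lt_geF lts; apply/negP => st.
  move: lts; rewrite (ub_le_sup hs.2) //; split=> //; exact: set_valP.
exists 1 => // s _; rewrite leNgt; apply/negP => st; apply: nex.
by exists (\val s); split=> //; exact: set_valP.
Qed.

(** When [T] is bounded above, [t] is one of the points below [sup T], so it is at most
    [bwd_jump (sup T)] and escapes the removed half-open interval. *)
Lemma kappa_lt s t : \val t < \val s -> ts_kappa T (\val t).
Proof.
move=> ts; rewrite /ts_kappa; case: pselect => /= [hub|?]; last exact: set_valP.
split; first exact: set_valP.
have hs : \val s <= sup T by apply: ub_le_sup => //; exact: set_valP.
rewrite /= in_itv /= => /andP[+ _]; apply/negP; rewrite -leNgt /bwd_jump.
have tsup := lt_le_trans ts hs.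
case: pselect => /= [?|]; last first.
  by case; exists (\val t); split=> //; exact: set_valP.
apply: ub_le_sup; last by split=> //; exact: set_valP.
by exists (sup T) => y [_ /ltW].
Qed.

(** Outside [ts_kappa] a solution satisfies no equation. That such a point is an isolated maximum
    replaces it: continuity is then automatic and [sigma] fixes the point. *)
Lemma not_kappa_max t : ~ ts_kappa T (\val t) ->
  (forall s : T, \val s <= \val t) /\ ~ left_dense t.
Proof.
move=> nk.
have tmax s : \val s <= \val t.
  by rewrite leNgt; apply/negP => /kappa_lt.
split=> // ld; apply: nk; rewrite /ts_kappa; case: pselect => /= [hub|?]; last exact: set_valP.
split; first exact: set_valP.
have -> : sup T = \val t.
  apply/eqP; rewrite eq_le ub_le_sup ?andbT //; last exact: set_valP.
  apply: ge_sup; first by exists (\val t); exact: set_valP.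
  by move=> y Ty; exact: (tmax (exist _ y (mem_set Ty))).
by rewrite ld /= in_itv /= ltxx.
Qed.

Lemma ts_nbhsP t (P : set T) :
  nbhs t P <-> exists2 d, 0 < d & forall s : T, `|\val t - \val s| < d -> P s.
Proof.
rewrite nbhs_ballP; by split=> -[d d0 h]; exists d => // s; exact: h.
Qed.

(** Let [c] be the supremum of the points up to which [Q] holds throughout. Closedness puts [c] in
    the time scale, [Q c] holds, and if [c] were below [b], one of the two forward steps would lead
    past [c]. *)
Lemma time_scale_induction a b (Q : T -> Prop) :
  Q a ->
  (forall t : T, \val a <= \val t < \val b -> \val t < \val (sigma t) ->
    Q t -> Q (sigma t)) ->
  (forall t : T, \val a <= \val t < \val b -> right_dense t -> Q t ->
    exists2 d, 0 < d & forall s : T, \val t < \val s < \val t + d -> Q s) ->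
  (forall t : T, \val a < \val t <= \val b ->
    (forall d, 0 < d -> exists2 s : T, \val t - d < \val s < \val t & \val a <= \val s) ->
    (forall s : T, \val a <= \val s < \val t -> Q s) -> Q t) ->
  forall t : T, \val a <= \val t <= \val b -> Q t.
Proof.
move=> Qa Qs Qr Ql t0 /andP[at0 t0b].
pose S := [set u | exists2 t : T, \val t = u & \val a <= u <= \val b /\
  forall s : T, \val a <= \val s <= u -> Q s].
have ab := le_trans at0 t0b.
have Sa : S (\val a).
  exists a => //; rewrite lexx ab; split=> // s /andP[h1 h2].
  by have -> : s = a by apply/val_inj/eqP; rewrite eq_le h1 h2.
have hS : has_sup S by split; [exists (\val a) | exists (\val b) => u [? _ [/andP[]]]].
have Sle u : S u -> u <= sup S by apply: ub_le_sup hS.2 _.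
have Tc : ts_set T (sup S).
  apply: ts_closed => B /nbhs_ballP[e /= e0 eB].
  have [u Su ue] := sup_adherent e0 hS.
  exists u; split; first by case: Su => t <- _; exact: set_valP.
  apply: eB; rewrite /ball /= ger0_norm ?subr_ge0 ?Sle //.
  by rewrite ltrBlDl -ltrBlDr.
pose c : T := exist _ (sup S) (mem_set Tc).
have cE : \val c = sup S by [].
have cb : \val c <= \val b 
  by apply: ge_sup; [exact: (ex_intro _ _ Sa) | move=> u [? _ [/andP[]]]].
have ac : \val a <= \val c by exact: Sle.
have Qltc s : \val a <= \val s < \val c -> Q s.
  move=> /andP[as_]; rewrite -subr_gt0 => sc.
  have [u [t <- [_ Qt]]] := sup_adherent sc hS.
  by rewrite -cE subKr => st; apply: Qt; rewrite as_ ltW.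
have Qc : Q c.
  (* If the supremum is not attained, [c] is a limit of points of [S] from the left, and the limit
     hypothesis [Ql] applies. *)
  have [[t tE [_ Qt]]|nSc] := pselect (S (\val c)).
    by apply: Qt; rewrite ac lexx.
  have ltac : \val a < \val c.
    rewrite lt_neqAle ac andbT; apply/negP => /eqP acE.
    by apply: nSc; rewrite -acE.
  apply: Ql => //; first by rewrite ltac.
  move=> d d0; have [u Su ud] := sup_adherent d0 hS.
  move: (Su) => [t tE [/andP[au _] _]]; exists t; rewrite tE //.
  rewrite -cE in ud; rewrite ud lt_neqAle Sle // andbT.
  by apply/negP => /eqP uE; apply: nSc; move: Su; rewrite uE.
have Qlec s : \val a <= \val s <= \val c -> Q s.
  rewrite [_ <= \val c]le_eqVlt => /andP[h /orP[/eqP/val_inj -> //|h2]].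
  by apply: Qltc; rewrite h h2.
suff cbE : \val c = \val b by apply: Qlec; rewrite at0 cbE.
apply/eqP; rewrite eq_le cb leNgt /=; apply/negP => ltcb.
(* With [c] below [b], either case yields an element of [S] beyond its supremum: a nearby point if
   [c] is right-dense, [sigma c] otherwise. *)
have [scE|/eqP nsc] := pselect (right_dense c).
  have [|d d0 dQ] := Qr c _ scE Qc; first by rewrite ac.
  have [u /andP[cu ud] ub] := right_dense_approx scE ltcb d0.
  suff : S (\val u) by move/Sle; rewrite leNgt cu.
  exists u => //; split; first by rewrite ub (le_trans ac) // ltW.
  move=> s /andP[as_ su]; have [sc|cs] := leP (\val s) (\val c).
    by apply: Qlec; rewrite as_.
  by apply: dQ; rewrite cs (le_lt_trans su).
have ltcs : \val c < \val (sigma c) by rewrite lt_neqAle eq_sym nsc sigma_ge.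
suff : S (\val (sigma c)) by move/Sle; rewrite leNgt ltcs.
exists (sigma c) => //; split; first by rewrite sigma_le // (le_trans ac) // ltW.
move=> s /andP[as_ su]; have [sc|cs] := leP (\val s) (\val c).
  by apply: Qlec; rewrite as_.
suff -> : s = sigma c by apply: Qs; rewrite // ac.
by apply/val_inj/eqP; rewrite eq_le su sigma_le.
Qed.

End TimeScaleOrder.

(** * Delta derivatives, continuity, and the mean value inequality *)

Section DeltaDerivative.
Variables (R : realType) (T : timeScale R).
Implicit Types (s t a b : T) (e C : R) (f g : T -> quat R) (l m q : quat R).

Definition ts_continuous f t : Prop :=
  forall e, 0 < e -> \forall s \near t, quat_abs (f s - f t) <= e.

Lemma near_ball t e : 0 < e -> \forall s \near t, `|\val t - \val s| < e.
Proof. by move=> e0; apply/ts_nbhsP; exists e. Qed.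

Lemma delta_derivative_near f t l : is_delta_derivative f t l <->
  forall e, 0 < e -> \forall s \near t,
    quat_abs (f (sigma t) - f s - l * quat_real (\val (sigma t) - \val s))
      <= e * `|\val (sigma t) - \val s|.
Proof.
split=> h e /h.
  move=> [d d0 hd]; apply/ts_nbhsP; exists d => // s std; apply: hd.
  by rewrite -ltr_distl distrC.
move/ts_nbhsP => [d d0 hd]; exists d => // s std; apply: hd.
by rewrite distrC ltr_distl.
Qed.

(** The choice [s = t] in the definition bounds the difference of the two sides by [e * mu t] for
    every positive [e]. *)
Lemma delta_derivative_sigma f t l : is_delta_derivative f t l ->
  f (sigma t) = f t + l * quat_real (mu t).
Proof.
move=> /delta_derivative_near fl; apply/eqP; rewrite -subr_eq0 opprD addrA.
apply/eqP/quat_abs_eq0/eqP; rewrite eq_le quat_abs_ge0 andbT.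
have mu0 : 0 <= mu t by rewrite subr_ge0 sigma_ge.
apply/ler_addgt0Pr => e e0; rewrite add0r.
have e1 : 0 < e / (mu t + 1) by rewrite divr_gt0 // ltr_wpDl.
apply: le_trans (nbhs_singleton (fl _ e1)) _.
rewrite -/(mu t) ger0_norm // mulrAC ler_pdivrMr ?ltr_wpDl //.
by rewrite ler_pM2l // lerDl.
Qed.

Lemma delta_derivative_continuous f t l :
  is_delta_derivative f t l -> ts_continuous f t.
Proof.
move=> fl e e0.
have fsE := delta_derivative_sigma fl.
have mu0 : 0 <= mu t by rewrite subr_ge0 sigma_ge.
have l0 := quat_abs_ge0 l.
(* For [s] within distance 1 of [t], the distance from [s] to [sigma t] is at most [mu t + 1], so
   the error term stays below [e / 2]. The constant [e2] does the same for the linear term. *)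
have e1 : 0 < e / 2 / (mu t + 1) by rewrite !divr_gt0 // ltr_wpDl.
have e2 : 0 < e / 2 / (quat_abs l + 1) by rewrite !divr_gt0 // ltr_wpDl.
move/delta_derivative_near : fl => fl; near=> s.
have st1 : `|\val t - \val s| < 1 by near: s; exact: near_ball.
have st2 : `|\val t - \val s| < e / 2 / (quat_abs l + 1).
  by near: s; exact: near_ball.
have h : quat_abs (f (sigma t) - f s - l * quat_real (\val (sigma t) - \val s))
    <= e / 2 / (mu t + 1) * `|\val (sigma t) - \val s|.
  by near: s; exact: fl.
have sE : \val (sigma t) - \val s = mu t + (\val t - \val s).
  by rewrite /mu; ring.
have -> : f s - f t = - (f (sigma t) - f s -
    l * quat_real (\val (sigma t) - \val s) + l * quat_real (\val t - \val s)).
  rewrite sE quat_realD mulrDr fsE.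
  move: (f t) (f s) (l * _) (l * _) => p q p' q'.
  by case: p q p' q' => [????] [????] [????] [????]; apply: quatP => /=; ring.
rewrite quat_absN; apply: le_trans (quat_abs_triangle _ _) _.
rewrite quat_absM quat_abs_real [e]splitr lerD //.
  apply: le_trans h _; rewrite mulrAC ler_pdivrMr ?ltr_wpDl //.
  rewrite ler_pM2l ?divr_gt0 // sE (le_trans (ler_normD _ _)) //.
  by rewrite ger0_norm // lerD2l ltW.
rewrite mulrC (le_trans (ler_wpM2r l0 (ltW st2))) // mulrAC.
by rewrite ler_pdivrMr ?ltr_wpDl // ler_pM2l ?divr_gt0 // lerDl.
Unshelve. all: by end_near. Qed.

(** With the slope enlarged to [C + e], the estimate propagates by induction along the time scale;
    the slack is then removed by letting it tend to zero. *)
Lemma mean_value_inequality f C a b : 0 <= C -> \val a <= \val b ->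
  (forall t : T, \val a <= \val t < \val b ->
    exists2 l, is_delta_derivative f t l & quat_abs l <= C) ->
  (forall t : T, \val a < \val t <= \val b -> ts_continuous f t) ->
  quat_abs (f b - f a) <= C * (\val b - \val a).
Proof.
move=> C0 ab hd hc; set r := \val b - \val a.
have r0 : 0 <= r by rewrite subr_ge0.
apply/ler_addgt0Pr => e0 e0_gt0.
pose e := e0 / (r + 1).
have e_gt0 : 0 < e by rewrite divr_gt0 // ltr_wpDl.
suff : quat_abs (f b - f a) <= (C + e) * r.
  move=> /le_trans; apply; rewrite mulrDl lerD2l mulrAC ler_pdivrMr ?ltr_wpDl //.
  by rewrite ler_pM2l // lerDl.
have Ce0 : 0 <= C + e by rewrite addr_ge0 // ltW.
(* One local estimate serves both forward steps: [s = t] gives the jump, and [sigma t = t] gives the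
   right-dense case. *)
have step t : \val a <= \val t < \val b ->
    \forall s \near t, quat_abs (f (sigma t) - f s)
      <= (C + e) * `|\val (sigma t) - \val s|.
  move=> /hd[l /delta_derivative_near /(_ _ e_gt0) fl lC].
  near=> s.
  have h : quat_abs (f (sigma t) - f s - l * quat_real (\val (sigma t) - \val s))
      <= e * `|\val (sigma t) - \val s|.
    by near: s; exact: fl.
  rewrite -[f _ - _](subrK (l * quat_real (\val (sigma t) - \val s))).
  apply: le_trans (quat_abs_triangle _ _) _.
  rewrite addrC mulrDl lerD // quat_absM quat_abs_real.
  exact: ler_wpM2r.
pose Q t := quat_abs (f t - f a) <= (C + e) * (\val t - \val a).
apply: (@time_scale_induction _ _ a b Q); last by rewrite ab lexx.
- by rewrite /Q !subrr quat_abs0 mulr0.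
- move=> t atb ts; rewrite /Q => Qt.
  apply: le_trans (quat_abs_dist _ (f t) _) _.
  apply: le_trans (lerD (nbhs_singleton (step t atb)) Qt) _.
  by rewrite -mulrDr addrA ger0_norm ?subrK // subr_ge0 ltW.
- move=> t atb td Qt; have /ts_nbhsP[d d0 hs] := step t atb.
  exists d => // s /andP[ts std]; rewrite /Q.
  have st : `|\val t - \val s| = \val s - \val t.
    by rewrite distrC ger0_norm // subr_ge0 ltW.
  have tE : sigma t = t := val_inj td.
  have := hs s; rewrite tE st ltrBlDl => /(_ std) h.
  apply: le_trans (quat_abs_dist _ (f t) _) _.
  rewrite quat_abs_sub.
  apply: le_trans (lerD h Qt) _.
  by rewrite -mulrDr addrA subrK.
(* At a limit from the left, continuity carries the estimate over from a nearby smaller point, up to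
   an arbitrary [e1]. *)
move=> t atb approx Qlt; rewrite /Q; apply/ler_addgt0Pr => e1 e1_gt0.
have /ts_nbhsP[d d0 hs] := hc t atb _ e1_gt0.
have [s /andP[ds st] as_] := approx d d0.
apply: le_trans (quat_abs_dist _ (f s) _) _; rewrite addrC lerD //.
  have := Qlt s; rewrite as_ st => /(_ isT) /le_trans; apply.
  by rewrite ler_wpM2l // lerD2r ltW.
rewrite quat_abs_sub; apply: hs; rewrite ger0_norm ?subr_ge0 ?ltW //.
by rewrite ltrBlDl -ltrBlDr.
Unshelve. all: by end_near. Qed.

End DeltaDerivative.

(** * Propagation of clopen properties and local boundedness of rd-continuous functions *)

Section LocalBound.
Variables (R : realType) (T : timeScale R).
Implicit Types (s t a b : T).

Lemma near_forall (I : finType) (P : I -> T -> Prop) t :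
  (forall i, \forall s \near t, P i s) -> \forall s \near t, forall i, P i s.
Proof. exact: (@filter_forall T I P (nbhs t)). Qed.

(** In the induction, openness of [P] covers right-dense points, openness of its complement covers
    limits from the left, and stability under [sigma] covers jumps. *)
Lemma clopen_forward (P : T -> Prop) a b :
  (forall t, P t -> \forall s \near t, P s) ->
  (forall t, ~ P t -> \forall s \near t, ~ P s) ->
  (forall t, P t -> P (sigma t)) ->
  \val a <= \val b -> P a -> P b.
Proof.
move=> Po Pc Ps ab Pa.
apply: (@time_scale_induction _ _ a b P) => //; last by rewrite ab lexx.
- by move=> t _ _; exact: Ps.
- move=> t _ _ /Po /ts_nbhsP[d d0 h]; exists d => // s /andP[ts std].
  by apply: h; rewrite distrC ger0_norm ?subr_ge0 ?ltW // ltrBlDl.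
move=> t _ approx Plt; apply: contrapT => /Pc /ts_nbhsP[d d0 h].
have [s /andP[ds st] as_] := approx d d0.
apply: (h s); last by apply: Plt; rewrite as_ st.
by rewrite ger0_norm ?subr_ge0 ?ltW // ltrBlDl -ltrBlDr.
Qed.

(** To go backwards, the forward version is applied to the complement of [P], which is also stable
    under [sigma] because of the equivalence. *)
Lemma clopen_total (P : T -> Prop) a b :
  (forall t, P t -> \forall s \near t, P s) ->
  (forall t, ~ P t -> \forall s \near t, ~ P s) ->
  (forall t, P t <-> P (sigma t)) ->
  P a -> P b.
Proof.
move=> Po Pc Ps Pa; have [ab|/ltW ba] := leP (\val a) (\val b).
  by apply: clopen_forward ab Pa => // t /Ps.
apply: contrapT => nPb.
apply: (clopen_forward (P := fun t => ~ P t) _ _ _ ba nPb) => //.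
  move=> t /contrapT /Po; apply: filterS => s Pus; exact.
by move=> t nPt Pst; apply/nPt/(Ps t).2.
Qed.

(** On each side of [t], either density gives a limit and hence a bound, or there is a gap and no
    nearby point has to be bounded. The value at [t] itself is added separately. *)
Lemma rd_continuous_real_bounded (g : T -> R) t : rd_continuous_real g ->
  exists K, \forall s \near t, `|g s| <= K.
Proof.
move=> [gr gl].
have dist_le (l : R) u : `|l - u| <= 1 -> `|u| <= `|l| + 1.
  move=> h; rewrite -[u](subKr l) (le_trans (ler_normB _ _)) //.
  by rewrite lerD2l.
have [K1 h1] : exists K, \forall s \near t, \val t < \val s -> `|g s| <= K.
  have [td|/eqP nd] := pselect (right_dense t).
    exists (`|g t| + 1).
    have /cvgrPdist_le /(_ _ ltr01) := gr t td.
    by apply: filterS => s /dist_le.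
  (* No point lies strictly between [t] and [sigma t], so any bound will do on this radius. *)
  exists 0; apply/ts_nbhsP; exists (\val (sigma t) - \val t).
    by rewrite subr_gt0 lt_neqAle eq_sym nd sigma_ge.
  move=> s + ts; have := sigma_le ts; rewrite leNgt distrC => /negP sle.
  by rewrite gtr0_norm ?subr_gt0 // ltrBlDr subrK => /sle.
have [K2 h2] : exists K, \forall s \near t, \val s < \val t -> `|g s| <= K.
  have [/gl[l]|/not_left_dense_gap[d d0 h]] := pselect (left_dense t).
    move=> /cvgrPdist_le /(_ _ ltr01); rewrite near_withinE => h.
    exists (`|l| + 1); apply: filterS h => s h /h; exact: dist_le.
  exists 0; apply/ts_nbhsP; exists d => // s + st.
  by rewrite gtr0_norm ?subr_gt0 // ltrBlDl -ltrBlDr => /h; rewrite leNgt st.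
exists (`|g t| + `|K1| + `|K2|); near=> s.
have [st|ts|/val_inj ->] := ltgtP (\val s) (\val t); last first.
- by rewrite -addrA lerDl addr_ge0.
- rewrite addrAC ler_wpDl ?addr_ge0 //; apply: le_trans (ler_norm _).
  by move: ts; near: s.
- rewrite ler_wpDl ?addr_ge0 //; apply: le_trans (ler_norm _).
  by move: st; near: s.
Unshelve. all: by end_near. Qed.

Lemma rd_continuous_bounded (f : T -> quat R) t : rd_continuous f ->
  exists K, \forall s \near t, quat_abs (f s) <= K.
Proof.
move=> [/(rd_continuous_real_bounded t)[K1 h1]
  /(rd_continuous_real_bounded t)[K2 h2] /(rd_continuous_real_bounded t)[K3 h3]
  /(rd_continuous_real_bounded t)[K4 h4]].
exists (K1 + K2 + K3 + K4).
near=> s; apply: le_trans (quat_abs_le_comp _) _.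
by rewrite !lerD //; near: s.
Unshelve. all: by end_near. Qed.

End LocalBound.

(** * Solutions with a zero vanish identically *)

Section Solutions.
Variables (R : realType) (T : timeScale R) (n : nat).
Variable A : T -> 'M[quat R]_n.
Implicit Types (s t c : T) (x : T -> qcol R n).

Lemma solution_continuous x t i :
  is_solution A x -> ts_continuous (fun s => x s i 0) t.
Proof.
move=> xsol; have [/xsol/(_ i)|] := pselect (ts_kappa T (\val t)).
  exact: delta_derivative_continuous.
move=> /not_kappa_max[tmax /not_left_dense_gap[d d0 h]] e e0.
apply/ts_nbhsP; exists d => // s.
rewrite ger0_norm ?subr_ge0 // ltrBlDl -ltrBlDr => /h ts.
have -> : s = t by apply/val_inj/eqP; rewrite eq_le ts tmax.
by rewrite subrr quat_abs0 ltW.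
Qed.

Lemma solution_sigma x t : is_solution A x -> ts_kappa T (\val t) ->
  x (sigma t) = (1%:M + quat_real (mu t) *: A t) *m x t.
Proof.
move=> xsol tk; apply/colP => i.
rewrite (delta_derivative_sigma (xsol t tk i)) mulmxDl mul1mx -scalemxAl.
by rewrite !mxE quat_realC.
Qed.

(** In [ts_kappa] the values at [t] and [sigma t] differ by the factor
    [1%:M + quat_real (mu t) *: A t], invertible by regressivity; elsewhere [sigma t] is [t]. *)
Lemma solution_sigma_eq0 x t : regressive A -> is_solution A x ->
  x t = 0 <-> x (sigma t) = 0.
Proof.
move=> Areg xsol; have [tk|] := pselect (ts_kappa T (\val t)); last first.
  by move=> /not_kappa_max[/sigma_max -> _].
rewrite solution_sigma //; split=> [->|h0]; first exact: mulmx0.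
have [C [_ CB]] := Areg t tk.
by rewrite -[LHS]mul1mx -CB -mulmxA h0 mulmx0.
Qed.

(** By continuity, a coordinate that is nonzero at [t] changes nearby by at most half of its
    modulus, so it cannot reach zero. *)
Lemma solution_neq0_near x t : is_solution A x ->
  x t <> 0 -> \forall s \near t, x s <> 0.
Proof.
move=> xsol xt0.
have [i xi0] : exists i, x t i 0 <> 0.
  apply: contrapT => nex; apply: xt0; apply/colP => i; rewrite mxE.
  by apply: contrapT => ?; apply: nex; exists i.
have v0 : 0 < quat_abs (x t i 0).
  rewrite lt_neqAle quat_abs_ge0 andbT eq_sym; apply/eqP.
  by move/quat_abs_eq0.
have v2 : 0 < quat_abs (x t i 0) / 2 by rewrite divr_gt0.
have := solution_continuous t i xsol v2; apply: filterS => s + xs0.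
by rewrite xs0 mxE sub0r quat_absN; lra.
Qed.

(* Near [c] the coordinates of [x] are at most [1] and every entry of [A] is
   bounded, so by the mean value inequality a bound [m] for the coordinates
   improves to [m / 2] on a small enough neighbourhood that does not depend
   on [m]. *)
Lemma solution_eq0_near x c : rd_continuous_mx A -> is_solution A x ->
  x c = 0 -> \forall s \near c, x s = 0.
Proof.
move=> Ard xsol xc0.
have /choice[K hK] : forall ij : 'I_n * 'I_n, exists K,
    \forall s \near c, quat_abs (A s ij.1 ij.2) <= K.
  by move=> [i j]; exact: rd_continuous_bounded.
pose B i : R := \sum_j `|K (i, j)|.
have B0 i : 0 <= B i by exact: sumr_ge0.
have h1 : \forall s \near c, forall ij, quat_abs (A s ij.1 ij.2) <= K ij.
  by apply: near_forall => ij; exact: hK.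
have h2 : \forall s \near c, forall i, quat_abs (x s i 0) <= 1.
  apply: near_forall => i; have := solution_continuous c i xsol (@ltr01 R).
  by apply: (filterS (F := nbhs c)) => s; rewrite xc0 mxE subr0.
have h3 : \forall s \near c, forall i, B i * `|\val c - \val s| <= 1 / 2.
  apply: near_forall => i.
  have e0 : 0 < 1 / 2 / (B i + 1) by rewrite !divr_gt0 // ltr_wpDl.
  apply/ts_nbhsP; exists (1 / 2 / (B i + 1)) => // s.
  rewrite ltr_pdivlMr ?ltr_wpDl // => /ltW; apply: le_trans.
  by rewrite mulrC ler_wpM2l // lerDl.
have /ts_nbhsP[d d0 hd] : \forall s \near c,
    [/\ forall ij, quat_abs (A s ij.1 ij.2) <= K ij,
       forall i, quat_abs (x s i 0) <= 1 &
       forall i, B i * `|\val c - \val s| <= 1 / 2].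
  by near=> s; split; near: s.
have halving k s i : `|\val c - \val s| < d -> quat_abs (x s i 0) <= (1 / 2) ^+ k.
  elim: k s i => [|k IHk] s i sd.
    by rewrite expr0; have [_ + _] := hd _ sd; exact.
  have m0 : 0 <= (1 / 2 : R) ^+ k by rewrite exprn_ge0.
  (* The strict upper bound places [t] below another point of the time scale, hence in [ts_kappa],
     where the equation holds. *)
  have deriv t : `|\val c - \val t| < d -> \val t < Num.max (\val s) (\val c) ->
      exists2 l, is_delta_derivative (fun s => x s i 0) t l &
        quat_abs l <= B i * (1 / 2) ^+ k.
    move=> td tmax; exists ((A t *m x t) i 0).
      apply: xsol; move: tmax; rewrite lt_max => /orP[]; exact: kappa_lt.
    rewrite mxE; apply: le_trans (quat_abs_sum _) _.
    rewrite /B mulr_suml; apply: ler_sum => j _.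
    rewrite quat_absM ler_pM ?quat_abs_ge0 //; last exact: IHk.
    by apply: le_trans (ler_norm _); have [+ _ _] := hd _ td; move/(_ (i, j)).
  have mvi : quat_abs (x s i 0) <= B i * (1 / 2) ^+ k * `|\val c - \val s|.
    have C0 : 0 <= B i * (1 / 2) ^+ k by rewrite mulr_ge0.
    have cont t : ts_continuous (fun s => x s i 0) t by exact: solution_continuous.
    have [cs|/ltW sc] := leP (\val c) (\val s).
      have := mean_value_inequality C0 cs _ (fun t _ => cont t).
      rewrite xc0 mxE subr0 [in `|_|]distrC ger0_norm ?subr_ge0 //; apply.
      move=> t /andP[ct ts]; apply: deriv; last by rewrite lt_max ts.
      apply: le_lt_trans sd; rewrite !(distrC (\val c)).
      by rewrite !ger0_norm ?subr_ge0 // ?(le_trans ct) ?lerD2r // ltW.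
    have := mean_value_inequality C0 sc _ (fun t _ => cont t).
    rewrite xc0 mxE sub0r quat_absN ger0_norm ?subr_ge0 //; apply.
    move=> t /andP[st tc]; apply: deriv; last by rewrite lt_max tc orbT.
    apply: le_lt_trans sd.
    by rewrite !ger0_norm ?subr_ge0 // ?lerD2l ?lerN2 // ltW.
  apply: le_trans mvi _; rewrite mulrAC exprS ler_wpM2r //.
  by have [_ _] := hd _ sd; exact.
apply/ts_nbhsP; exists d => // s sd; apply/colP => i; rewrite mxE.
apply/quat_abs_eq0/eqP; rewrite eq_le quat_abs_ge0 andbT.
have half1 : `|1 / 2 : R| < 1 by rewrite ger0_norm //; lra.
apply/ler_addgt0Pr => e e0; rewrite add0r.
have /cvgrPdist_le /(_ _ e0) := cvg_expr half1.
move=> /filter_ex[k]; rewrite sub0r normrN.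
move=> /(le_trans (ler_norm _)); exact: le_trans (halving k s i sd).
Unshelve. all: by end_near. Qed.

Lemma solution_unique0 x c : rd_continuous_mx A -> regressive A ->
  is_solution A x -> x c = 0 -> forall t, x t = 0.
Proof.
move=> Ard Areg xsol xc0 t.
apply: (clopen_total (P := fun t => x t = 0)) xc0 => {c t} t.
- exact: solution_eq0_near.
- exact: solution_neq0_near.
- exact: solution_sigma_eq0.
Qed.

End Solutions.

(** * Injectivity implies surjectivity for square quaternion matrices *)

Section RealCoordinates.
Variables (R : realType) (n : nat).

(** One real column per quaternion component, so that the product inherits the structure of a
    finite-dimensional real vector space. *)
Definition real_coord : Type := 'cV[R]_n * 'cV[R]_n * 'cV[R]_n * 'cV[R]_n.
HB.instance Definition _ := Vector.on real_coord.

Definition of_real_coord (u : real_coord) : 'cV[quat R]_n :=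
  let: (a, b, c, d) := u in \col_i Quat (a i 0) (b i 0) (c i 0) (d i 0).

Definition to_real_coord (v : 'cV[quat R]_n) : real_coord :=
  (\col_i qre (v i 0), \col_i qi (v i 0), \col_i qj (v i 0), \col_i qk (v i 0)).

Lemma of_real_coordK : cancel of_real_coord to_real_coord.
Proof.
by move=> [[[a b] c] d]; congr (_, _, _, _); apply/colP => i; rewrite !mxE.
Qed.

Lemma to_real_coordK : cancel to_real_coord of_real_coord.
Proof. by move=> v; apply/colP => i; rewrite !mxE; case: (v i 0). Qed.

Lemma of_real_coordP k u v :
  of_real_coord (k *: u + v) = quat_real k *: of_real_coord u + of_real_coord v.
Proof.
case: u v => [[[a b] c] d] [[[a' b'] c'] d']; apply/colP => i.
by rewrite !mxE; apply: quatP => /=; ring.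
Qed.

Variable B : 'M[quat R]_n.

Definition real_coord_mul (u : real_coord) : real_coord :=
  to_real_coord (B *m of_real_coord u).

(** Real quaternions are central, so a real scalar moves past the entries of [B]. *)
Lemma real_coord_mul_is_linear : linear real_coord_mul.
Proof.
move=> k u v; apply: (can_inj of_real_coordK).
rewrite of_real_coordP !to_real_coordK of_real_coordP mulmxDr; congr (_ + _).
apply/colP => i; rewrite !mxE mulr_sumr; apply: eq_bigr => j _.
by rewrite !mxE !mulrA quat_realC.
Qed.
HB.instance Definition _ :=
  GRing.isLinear.Build R real_coord real_coord _ real_coord_mul
    real_coord_mul_is_linear.

(* Left multiplication by [B] is R-linear on H^n = R^(4n), so dimension
   counting over the field R replaces linear algebra over a skew field. *)
Lemma quat_mx_inj_surj :
  (forall v : 'cV[quat R]_n, B *m v = 0 -> v = 0) ->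
  forall w : 'cV[quat R]_n, exists v : 'cV[quat R]_n, B *m v = w.
Proof.
move=> Binj w; pose f := linfun real_coord_mul.
have f_inj : lker f == 0%VS.
  apply/lker0P => u v; rewrite !lfunE /= => /(can_inj to_real_coordK) /eqP.
  rewrite -subr_eq0 -mulmxBr => /eqP /Binj /eqP.
  by rewrite subr_eq0 => /eqP /(can_inj of_real_coordK).
exists (of_real_coord (f^-1%VF (to_real_coord w))).
have := lker0_lfunVK f_inj (to_real_coord w).
by rewrite {1}/f lfunE => /(can_inj to_real_coordK).
Qed.

End RealCoordinates.

(** * The right module of solutions and the representation by a fundamental matrix *)

Section SolutionModule.
Variables (R : realType) (T : timeScale R) (n : nat).
Variable A : T -> 'M[quat R]_n.

Lemma delta_derivative_lin (f g : T -> quat R) t l m q :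
  is_delta_derivative f t l -> is_delta_derivative g t m ->
  is_delta_derivative (fun s => f s * q + g s) t (l * q + m).
Proof.
move=> /delta_derivative_near fl /delta_derivative_near gm.
apply/delta_derivative_near => e e0.
have q1 : 0 < quat_abs q + 1 by rewrite ltr_wpDl ?quat_abs_ge0.
have e1 : 0 < e / 2 / (quat_abs q + 1) by rewrite !divr_gt0.
have e2 : 0 < e / 2 by rewrite divr_gt0.
near=> s.
have hf : quat_abs (f (sigma t) - f s - l * quat_real (\val (sigma t) - \val s))
    <= e / 2 / (quat_abs q + 1) * `|\val (sigma t) - \val s|.
  by near: s; exact: fl.
have hg : quat_abs (g (sigma t) - g s - m * quat_real (\val (sigma t) - \val s))
    <= e / 2 * `|\val (sigma t) - \val s|.
  by near: s; exact: gm.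
set r := \val (sigma t) - \val s in hf hg *.
(* The real increment [r] commutes with [q], so [q] factors out on the right of the error term of
   [f], and its modulus is absorbed by the choice of [e1]. *)
have -> : f (sigma t) * q + g (sigma t) - (f s * q + g s) -
    (l * q + m) * quat_real r =
    (f (sigma t) - f s - l * quat_real r) * q +
    (g (sigma t) - g s - m * quat_real r).
  rewrite mulrDl -(mulrA l) -quat_realC mulrA !mulrBl.
  move: (f _ * q) (f _ * q) (g _) (g _) (l * _ * q) (m * _).
  case=> [????] [????] [????] [????] [????] [????].
  by apply: quatP => /=; ring.
apply: le_trans (quat_abs_triangle _ _) _.
rewrite quat_absM [e in _ <= e * _]splitr mulrDl lerD //.
apply: le_trans (ler_wpM2r (quat_abs_ge0 q) hf) _.
rewrite mulrAC ler_wpM2r // mulrAC ler_pdivrMr // ler_pM2l //.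
by rewrite lerDl.
Unshelve. all: by end_near. Qed.

Lemma solution0 : is_solution A (fun => 0).
Proof.
move=> t _ i; rewrite mulmx0 mxE => e e0; exists 1 => // s _.
by rewrite subrr mul0r subrr quat_abs0 mulr_ge0 // ltW.
Qed.

Lemma solution_lin (a : (quat R)^c) (x y : T -> qcol R n) :
  is_solution A x -> is_solution A y -> is_solution A (fun t => a *: x t + y t).
Proof.
move=> xsol ysol t tk i.
have := delta_derivative_lin a (xsol t tk i) (ysol t tk i).
have -> : (A t *m x t) i 0 * a + (A t *m y t) i 0 =
    (A t *m (a *: x t + y t)) i 0.
  rewrite mulmxDr !mxE mulr_suml; congr (_ + _); apply: eq_bigr => j _.
  by rewrite !mxE mulrA.
by congr (is_delta_derivative _ t _); apply/funext => s; rewrite !mxE.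
Qed.

Lemma solution_submod_closed :
  GRing.submod_closed (mem [set x : T -> qcol R n | is_solution A x]).
Proof.
split=> [|a x y]; rewrite !inE; first exact: solution0.
exact: solution_lin.
Qed.

Lemma solution_sum (x : 'I_n -> T -> qcol R n) (a : 'I_n -> (quat R)^c) :
  (forall j, is_solution A (x j)) ->
  is_solution A (fun t => \sum_j a j *: x j t).
Proof.
move=> xsol; elim: (index_enum _) => [|j s IHs].
  by have := solution0; congr is_solution; apply/funext => t; rewrite big_nil.
have := solution_lin (a j) (xsol j) IHs.
by congr is_solution; apply/funext => t; rewrite big_cons.
Qed.

(** This identifies products [M t *m q] with the right linear combinations of columns used in
    [right_lin_indep]. *)
Lemma mulmx_sum_scale_col (B : 'M[quat R]_n) (q : qcol R n) :
  B *m q = \sum_j (q j 0 : (quat R)^c) *: (col j B : qcol R n).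
Proof.
apply/colP => i; rewrite mxE summxE; apply: eq_bigr => j _.
by rewrite !mxE.
Qed.

End SolutionModule.

Theorem theorem4p19 (R : realType) (T : timeScale R) (n : nat)
    (A M : T -> 'M[quat R]_n)
    (hA : rd_continuous_mx A) (hreg : regressive A)
    (hM : is_fundamental_mx A M) :
  (forall x : T -> qcol R n, is_solution A x ->
     exists q : qcol R n, forall t : T, x t = M t *m q) /\
  GRing.submod_closed (mem [set x : T -> qcol R n | is_solution A x]).
Proof.
split; last exact: solution_submod_closed.
move=> x xsol; case: hM => Msol Mindep.
have Mqsol q : is_solution A (fun t => M t *m q).
  have := solution_sum (fun j => q j 0) Msol.
  congr is_solution; apply/funext => t.
  by rewrite mulmx_sum_scale_col.
have [r Tr] := ts_nonempty T; pose t0 : T := exist _ r (mem_set Tr).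
have Minj (v : 'cV_n) : M t0 *m v = 0 -> v = 0.
  move=> /(solution_unique0 hA hreg (Mqsol v)) Mv0.
  apply/colP => i; rewrite mxE.
  apply: (Mindep (fun j => v j 0)) => t.
  by rewrite -mulmx_sum_scale_col Mv0.
have [q Mq] := quat_mx_inj_surj Minj (x t0).
exists q => t.
(* The scalar [- 1] makes this solution the difference of [x] and [M q], which vanishes at [t0] by
   the choice of [q]. *)
have dsol := solution_lin (- 1) (Mqsol q) xsol.
apply/eqP; rewrite -subr_eq0 addrC -scaleN1r; apply/eqP.
apply: (solution_unique0 hA hreg dsol (c := t0)).
by rewrite Mq scaleN1r addNr.
Qed.
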